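(* Let $0<p<1$, $q=1-p$, let $\{\xi_i\}_{i=1}^\infty$ be a sequence of Bernoulli$(p)$ trials and let $X=\sum_{j=1}^\infty (j-1)\Big(\prod_{i=1}^{j-1}(1-\xi_i)\Big)\xi_j$, that is, $X$ is the number of trials with value $0$ before the first trial with value $1$. Then $X$ has a geometric distribution and the Meixner polynomials on this geometric distribution have a representation, for $n\ge 1$, of \begin{align*} M_n(X;1,q) &= \sum_{r=1}^\infty\ \sum_{i_1<\cdots<i_r}(\xi_{i_1}-p)\cdots(\xi_{i_r}-p)\,(-1)^{r-1}q^{\,i_r-r}M_{n-1}(i_r-1;1,q)\\ &=\sum_{r=1}^\infty\sum_{l=r}^\infty\frac{1}{(r-1)!}K_{r-1}(X_l;l,p)\,(\xi_l-p)\,(-1)^{r-1}q^{\,l-r}M_{n-1}(l-1;1,q), \end{align*} where $X_l=\xi_1+\cdots+\xi_l$.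
   Context: Bernoulli$(p)$ trials are independent random variables with $P(\xi_i=1)=p$, $P(\xi_i=0)=q$. The geometric distribution is $P(X=x)=pq^x$, $x=0,1,\ldots$. The Meixner polynomials orthogonal on this geometric distribution are defined by the generating function $$\sum_{n=0}^\infty M_n(x;1,q)z^n=(1-q^{-1}z)^x(1-z)^{-(x+1)}.$$ The Krawtchouk polynomials $K_n(x;N,p)$, $0\le n\le N$, orthogonal on the binomial $(N,p)$ distribution, are defined by $$\sum_{n=0}^N K_n(x;N,p)\frac{z^n}{n!}=(1+qz)^x(1-pz)^{N-x},\qquad x=0,1,\ldots,N.$$ In the first sum the indices $i_1<\cdots<i_r$ are positive integers.
   Formalization: The printed formulas are false (the first series sums to q·M_n(X)); the powers of q are corrected to q^{i_r-r-1} and q^{l-r-1}, and the Krawtchouk factor K_{r-1}(X_l;l,p) is corrected to K_{r-1}(X_{l-1};l-1,p). *)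

(* Defs.v *)
From HB Require Import structures.
From mathcomp Require Import all_boot all_order all_algebra finmap.
From mathcomp Require Import all_classical all_reals all_analysis.
From mathcomp.analysis Require Import showcase.summability.

Set Implicit Arguments.
Unset Strict Implicit.
Unset Printing Implicit Defensive.
Import Order.TTheory GRing.Theory Num.Theory.
Import numFieldNormedType.Exports.
Local Open Scope classical_set_scope.
Local Open Scope ring_scope.

(* M n is x |-> M_n(x; 1, q).  The power series has radius of convergence at
   least 1, and a polynomial is determined by its values on the naturals, so
   this pins down every M n. *)
Definition meixner_family (R : realType) (q : R) (M : nat -> {poly R}) : Prop :=
  forall (x : nat) (z : R), `|z| < 1 ->
    \sum_(0 <= n < m) (M n).[x%:R] * z ^+ n @[m --> \oo] -->
      (1 - q^-1 * z) ^+ x * (1 - z) ^- x.+1.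

(* K n N is x |-> K_n(x; N, p) for n <= N, with q = 1 - p; the values at
   x = 0, ..., N are the ones that are specified. *)
Definition krawtchouk_family (R : realType) (p : R)
    (K : nat -> nat -> {poly R}) : Prop :=
  forall (N x : nat) (z : R), (x <= N)%N ->
    \sum_(0 <= n < N.+1) (K n N).[x%:R] * (z ^+ n / n`!%:R) =
      (1 + (1 - p) * z) ^+ x * (1 - p * z) ^+ (N - x).

Section random_variables.
Context {d : measure_display} {T : measurableType d} {R : realType}.
Variable P : probability T R.

(* The trials are xi 1, xi 2, ...; xi 0 is unconstrained and never used. *)
Definition independent_trials (xi : nat -> {RV P >-> R}) : Prop :=
  forall (J : {fset nat}) (B : nat -> set R),
    (forall i, i \in J -> (0 < i)%N) -> (forall i, measurable (B i)) ->
    P (\bigcap_(i in [set` J]) (xi i @^-1` B i)) =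
      (\prod_(i <- J) P (xi i @^-1` B i))%E.

Definition bernoulli_trials (p : R) (xi : nat -> {RV P >-> R}) : Prop :=
  (forall i, (0 < i)%N ->
     P (xi i @^-1` [set 1]) = p%:E /\ P (xi i @^-1` [set 0]) = (1 - p)%:E) /\
  independent_trials xi.

Definition failures_partial (xi : nat -> {RV P >-> R}) (m : nat) (w : T) : R :=
  \sum_(1 <= j < m) (j.-1)%:R * (\prod_(1 <= i < j) (1 - xi i w)) * xi j w.

(* The partial sums converge almost surely; where they do not, the value is
   the default one of [lim]. *)
Definition failures (xi : nat -> {RV P >-> R}) (w : T) : R :=
  limn (fun m => failures_partial xi m w).

Definition successes (xi : nat -> {RV P >-> R}) (l : nat) (w : T) : R :=
  \sum_(1 <= i < l.+1) xi i w.

Definition geometric_rv (p : R) (Y : T -> R) : Prop :=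
  measurable_fun setT Y /\
  forall x : nat, P (Y @^-1` [set x%:R]) = (p * (1 - p) ^+ x)%:E.

(* Y = S 1 + S 2 + ..., both almost surely and in mean square. *)
Definition rv_series (S : nat -> {RV P >-> R}) (Y : T -> R) : Prop :=
  {ae P, forall w, \sum_(1 <= r < m) S r w @[m --> \oo] --> Y w} /\
  (\int[P]_w ((Y w - \sum_(1 <= r < m) S r w) ^+ 2)%:E @[m --> \oo] --> 0)%E.

End random_variables.

(* i_1 < ... < i_r with i_1 > 0. *)
Definition incr_tuple (r : nat) : Type :=
  {t : r.-tuple nat | path ltn 0%N t}.
HB.instance Definition _ (r : nat) := Choice.on (incr_tuple r).

Definition max_index (r : nat) (t : incr_tuple r) : nat := last 0%N (val t).

(* Unordered sum: the net of sums over finite subsets of I tends to s. *)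
Definition has_sum (R : realType) (I : choiceType) (f : I -> R) (s : R) : Prop :=
  partial_sum f @ totally --> s.

(* Main.v *)
Require Import Defs.
From mathcomp Require Import all_boot all_order all_algebra finmap.
From mathcomp Require Import all_classical all_reals all_analysis.
From mathcomp Require Import measurable_realfun.
From mathcomp.analysis Require Import showcase.summability.
From mathcomp Require Import ring lra zify.
Import Order.TTheory GRing.Theory Num.Theory.
Import numFieldNormedType.Exports.
Local Open Scope classical_set_scope.
Local Open Scope ring_scope.

Set Implicit Arguments.
Unset Strict Implicit.
Unset Printing Implicit Defensive.

(* Write [x j = xi j - p] and [y j = - x j / q], so that [1 + y j] is [1 / q] on
   a failure and [0] on a success.  The generating function gives
   [M_n(k) = M_(n-1)(k) - (p / q) sum_(l < k) M_(n-1)(l)], which on [X = k] is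
   the pathwise identity
     [M_n(X) = sum_j x (j + 1) q ^ (j - 1) M_(n-1)(j) prod_(i <= j) (1 + y i)].
   Expanding the product into elementary symmetric polynomials of the past and
   collecting the degrees yields the terms of order [r] of the representation.
   The terms of order larger than [m] leave the remainder obtained by replacing
   the product with the tail [T m j] of its expansion.  The [y i] are
   independent, centred, with variance [p / q], so [E (T m j) ^ 2 <= q ^ - j],
   and [T m j = 0] for [j < m]; with a weighted Cauchy-Schwarz inequality over
   [j] the second moment of the remainder is [O (theta ^ m)] for some
   [theta < 1].  This is summable in [m], which gives both the mean square and
   the almost sure convergence. *)

(** * Elementary symmetric polynomials and their second moments *)

Fixpoint elem_sym (R : comNzRingType) (v : seq R) (r : nat) : R :=
  match v, r with
  | _, 0 => 1
  | [::], _.+1 => 0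
  | x :: v', r'.+1 => elem_sym v' r + x * elem_sym v' r'
  end.

Lemma elem_sym0 (R : comNzRingType) (v : seq R) : elem_sym v 0 = 1.
Proof. by case: v. Qed.

Lemma coef_prod_elem_sym (R : comNzRingType) (v : seq R) (r : nat) :
  (\prod_(x <- v) (1 + x *: 'X) : {poly R})`_r = elem_sym v r.
Proof.
elim: v r => [|x v IH] r; first by rewrite big_nil coef1; case: r.
rewrite big_cons mulrDl mul1r coefD -scalerAl coefZ coefXM.
by case: r => [|r] /=; rewrite !IH ?elem_sym0 ?mulr0 ?addr0.
Qed.

Lemma size_prod_elem_sym (R : comNzRingType) (v : seq R) :
  (size (\prod_(x <- v) (1 + x *: 'X) : {poly R})%R <= (size v).+1)%N.
Proof.
elim: v => [|x v IH]; first by rewrite big_nil size_poly1.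
rewrite big_cons; apply: leq_trans (size_polyMleq _ _) _ => /=.
have : (size (1 + x *: 'X : {poly R})%R <= 2)%N.
  apply: leq_trans (size_polyD _ _) _; rewrite geq_max size_poly1 /=.
  by apply: leq_trans (size_scale_leq _ _) _; rewrite size_polyX.
by move=> h; have := leq_add h IH; case: (_ + _)%N.
Qed.

Lemma elem_sym_oversize (R : comNzRingType) (v : seq R) (r : nat) :
  (size v < r)%N -> elem_sym v r = 0.
Proof.
move=> vr; rewrite -coef_prod_elem_sym nth_default //.
exact: leq_trans (size_prod_elem_sym v) vr.
Qed.

Lemma sum_elem_sym (R : comNzRingType) (v : seq R) (m : nat) (z : R) :
  (size v < m)%N ->
  \sum_(0 <= r < m) elem_sym v r * z ^+ r = \prod_(x <- v) (1 + x * z).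
Proof.
move=> vm; rewrite big_mkord.
transitivity (\prod_(x <- v) (1 + x *: 'X)).[z].
  rewrite (horner_coef_wide z (leq_trans (size_prod_elem_sym v) vm)).
  by apply: eq_bigr => r _; rewrite coef_prod_elem_sym.
by rewrite horner_prod; apply: eq_bigr => x _; rewrite !hornerE.
Qed.

Lemma elem_sym_scale (R : comNzRingType) (c : R) (v : seq R) (r : nat) :
  elem_sym [seq c * x | x <- v] r = c ^+ r * elem_sym v r.
Proof.
elim: v r => [|x v IH] [|r] /=; rewrite ?expr0 ?mul1r ?mulr0 //.
by rewrite !IH exprS; ring.
Qed.

(** Up to absolute values, the left side is one term in the expansion of the product of the
    [1 + (c - 1) * |x|], whose factors are at most [c]. Taking [c] near 1 makes the growth in
    [size v] as slow as desired. *)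
Lemma norm_elem_sym_le (R : realDomainType) (c : R) (v : seq R) (r : nat) :
  1 <= c -> {in v, forall x, `|x| <= 1} ->
  (c - 1) ^+ r * `|elem_sym v r| <= c ^+ size v.
Proof.
move=> c1; elim: v r => [|x v IH] [|r] vle /=.
- by rewrite normr1 mulr1.
- by rewrite normr0 mulr0.
- by rewrite normr1 mulr1 expr0 exprn_ege1.
have vle' : {in v, forall x, `|x| <= 1}.
  by move=> y yv; apply: vle; rewrite inE yv orbT.
have x1 : `|x| <= 1 by apply: vle; rewrite inE eqxx.
apply: (@le_trans _ _ ((c - 1) ^+ r.+1 * `|elem_sym v r.+1| +
   (c - 1) * ((c - 1) ^+ r * `|elem_sym v r|))).
  rewrite mulrA -exprS -mulrDr ler_wpM2l ?exprn_ge0 ?subr_ge0 //.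
  apply: le_trans (ler_normD _ _) _; rewrite lerD2l normrM.
  by rewrite ler_piMl.
have -> : c ^+ (size v).+1 = c ^+ size v + (c - 1) * c ^+ size v.
  by rewrite exprS; ring.
by rewrite lerD ?IH // ler_wpM2l ?subr_ge0 ?IH.
Qed.

(** The part of degree at least [m] in the expansion of the product of the [1 + x]. *)
Definition elem_sym_tail (R : comNzRingType) (m : nat) (v : seq R) : R :=
  \prod_(x <- v) (1 + x) - \sum_(0 <= r < m) elem_sym v r.

(** For [m = 0] both tails are the full product, so [m.-1 = 0] is the right index there. *)
Lemma elem_sym_tail_cons (R : comNzRingType) (m : nat) (x : R) (v : seq R) :
  elem_sym_tail m (x :: v) = elem_sym_tail m v + x * elem_sym_tail m.-1 v.
Proof.
rewrite /elem_sym_tail big_cons; case: m => [|m].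
  by rewrite !big_geq // ; ring.
rewrite -pred_Sn ![\sum_(0 <= _ < m.+1) _]big_nat_recl // !elem_sym0 /=.
by rewrite big_split /= -mulr_sumr; ring.
Qed.

Lemma elem_sym_tail_oversize (R : comNzRingType) (m : nat) (v : seq R) :
  (size v < m)%N -> elem_sym_tail m v = 0.
Proof.
move=> /(sum_elem_sym 1) H; apply/eqP; rewrite subr_eq0; apply/eqP.
under eq_bigr do rewrite -[X in 1 + X]mulr1.
by rewrite -H; apply: eq_bigr => r _; rewrite expr1n mulr1.
Qed.

(** The latest outcome is at the head, as in [past] below, so that sums over words can condition on
    the latest trial. *)
Fixpoint bitseqs (j : nat) : seq bitseq :=
  if j is j'.+1 then
    [seq true :: s | s <- bitseqs j'] ++ [seq false :: s | s <- bitseqs j']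
  else [:: [::]].

Lemma mem_bitseqs (s : bitseq) : s \in bitseqs (size s).
Proof.
elim: s => [|b s IH] //=; rewrite mem_cat.
by case: b; rewrite map_f ?orbT.
Qed.

Lemma size_bitseqs (j : nat) (s : bitseq) : s \in bitseqs j -> size s = j.
Proof.
elim: j s => [|j IH] s /=; first by rewrite inE => /eqP ->.
by rewrite mem_cat => /orP[] /mapP[t /IH <- ->].
Qed.

Lemma uniq_bitseqs (j : nat) : uniq (bitseqs j).
Proof.
elim: j => [|j IH] //=; rewrite cat_uniq !map_inj_uniq ?IH /= ?andbT;
  try by move=> ? ? [].
by apply/hasPn => _ /mapP[s _ ->]; apply/mapP => -[].
Qed.

Definition bit_weight (R : nzRingType) (p : R) (s : bitseq) : R :=
  \prod_(b <- s) (if b then p else 1 - p).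

Lemma sum_bitseqsS (R : comNzRingType) (p : R) (F : bitseq -> R) (j : nat) :
  \sum_(s <- bitseqs j.+1) bit_weight p s * F s =
  \sum_(s <- bitseqs j) bit_weight p s *
     (p * F (true :: s) + (1 - p) * F (false :: s)).
Proof.
rewrite /= big_cat /= !big_map -big_split /=; apply: eq_bigr => s _.
by rewrite /bit_weight !big_cons; ring.
Qed.

Section second_moment.
Variables (R : realType) (p : R).
Hypotheses (hp0 : 0 < p) (hp1 : p < 1).

Definition bit_ratio (b : bool) : R := if b then - 1 else p / (1 - p).

(* The variables [bit_ratio] are centred with variance [p / (1 - p)], so the
   square of [a + y b] averages to [a ^ 2 + p / (1 - p) b ^ 2]. *)
Lemma elem_sym_tail_second_moment (j m : nat) :
  \sum_(s <- bitseqs j) bit_weight p s * elem_sym_tail m (map bit_ratio s) ^+ 2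
    <= (1 - p) ^- j.
Proof.
have q0 : 0 < 1 - p by rewrite subr_gt0.
have qn0 := lt0r_neq0 q0.
elim: j m => [|j IH] m.
  rewrite big_seq1 /bit_weight big_nil mul1r /elem_sym_tail /= big_nil expr0 invr1.
  case: m => [|m]; first by rewrite big_geq // subr0 expr1n.
  by rewrite big_nat_recl // big1 // addr0 subrr expr0n ler01.
rewrite sum_bitseqsS.
rewrite (eq_bigr (fun s : bitseq =>
    bit_weight p s * elem_sym_tail m (map bit_ratio s) ^+ 2 +
    p / (1 - p) * (bit_weight p s * elem_sym_tail m.-1 (map bit_ratio s) ^+ 2)));
  last first.
  by move=> s _; rewrite /= !elem_sym_tail_cons; field.
rewrite big_split /= -mulr_sumr.
(* The new factor arises from [1 + p / (1 - p) = 1 / (1 - p)]. *)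
apply: (@le_trans _ _ ((1 - p) ^- j + p / (1 - p) * (1 - p) ^- j)).
  by apply: lerD; rewrite ?IH // ler_wpM2l ?IH // divr_ge0 ?ltW.
by rewrite exprS invfM le_eqVlt; apply/orP; left; apply/eqP; field;
   rewrite expf_neq0.
Qed.

End second_moment.

(* Convexity of the square with weights [1 - s, (1 - s) s, ...]. *)
Lemma sqr_sum_le_weighted (R : realFieldType) (s : R) (a : nat -> R) (N : nat) :
  0 < s -> s < 1 ->
  (\sum_(0 <= j < N) a j) ^+ 2 <=
    (1 - s)^-1 * \sum_(0 <= j < N) s ^- j * a j ^+ 2.
Proof.
move=> s0 s1; have sn0 := lt0r_neq0 s0.
have t0 : 0 < 1 - s by rewrite subr_gt0.
have tn0 := lt0r_neq0 t0.
elim: N a => [|N IH] a; first by rewrite !big_geq // expr0n mulr0.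
rewrite !big_nat_recl // expr0 invr1 mul1r mulrDr.
set B := \sum_(0 <= j < N) a j.+1.
(* Two-point case with weights [1 - s] and [s]; the defect is an explicit square. *)
apply: (@le_trans _ _ ((1 - s)^-1 * a 0 ^+ 2 + s^-1 * B ^+ 2)).
  rewrite -subr_ge0.
  have -> : (1 - s)^-1 * a 0 ^+ 2 + s^-1 * B ^+ 2 - (a 0 + B) ^+ 2 =
    (s * a 0 - (1 - s) * B) ^+ 2 / (s * (1 - s)) by field; rewrite tn0 sn0.
  by rewrite divr_ge0 ?sqr_ge0 // mulr_ge0 ?ltW.
rewrite lerD2l; apply: (@le_trans _ _ (s^-1 * ((1 - s)^-1 *
   \sum_(0 <= j < N) s ^- j * a j.+1 ^+ 2))).
  by rewrite ler_wpM2l ?invr_ge0 ?(ltW s0) //; exact: IH.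
rewrite mulrCA ler_wpM2l ?invr_ge0 ?(ltW t0) // mulr_sumr.
by apply: ler_sum => j _; rewrite mulrA -invfM -exprS.
Qed.

Lemma nat_le_expr (R : realFieldType) (b : R) (n : nat) :
  1 <= b -> (b - 1) * n%:R <= b ^+ n.
Proof.
move=> b1; elim: n => [|n IH]; first by rewrite mulr0.
rewrite exprS -natr1 mulrDr mulr1.
apply: (@le_trans _ _ (b ^+ n + (b - 1) * b ^+ n)).
  by rewrite lerD // ler_peMr ?subr_ge0 // exprn_ege1.
by rewrite -{1}[b ^+ n]mul1r -mulrDl addrC subrK.
Qed.

(** Horner induction over all bases at once: with [b = e * e], one factor [e ^+ n] bounds the
    quotient polynomial and the other absorbs the multiplication by [n]. *)
Lemma poly_nat_le_expr (R : realType) (f : {poly R}) (b : R) : 1 < b ->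
  exists2 C, 0 <= C & forall n : nat, `|f.[n%:R]| <= C * b ^+ n.
Proof.
elim/poly_ind: f b => [|f c IH] b b1.
  by exists 0 => // n; rewrite horner0 normr0 mul0r.
have b0 : 0 < b by apply: lt_trans b1.
pose e := Num.sqrt b.
have e1 : 1 < e by rewrite -[ltLHS]sqrtr1 ltr_sqrt.
have [C C0 HC] := IH _ e1.
exists (C / (e - 1) + `|c|) => [|n].
  by rewrite addr_ge0 // divr_ge0 // subr_ge0 ltW.
rewrite !hornerE; apply: le_trans (ler_normD _ _) _.
rewrite mulrDl lerD //; last by rewrite ler_peMr // exprn_ege1 // ltW.
have -> : b = e * e by rewrite -expr2 sqr_sqrtr // ltW.
rewrite exprMn normrM (ger0_norm (ler0n _ n)) // mulrACA.
apply: ler_pM => //.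
by rewrite ler_pdivlMl ?subr_gt0 // nat_le_expr // ltW.
Qed.

(** * Meixner polynomials *)

Lemma sum_geometric_le (R : realFieldType) (z : R) (m n : nat) :
  0 <= z -> z < 1 -> \sum_(m <= k < n) z ^+ k <= z ^+ m / (1 - z).
Proof.
move=> z0 z1; have t0 : 0 < 1 - z by rewrite subr_gt0.
rewrite ler_pdivlMr //; have [nm|mn] := leqP n m.
  by rewrite big_geq // mul0r exprn_ge0.
rewrite mulr_suml (eq_bigr (fun k => - (z ^+ k.+1 - z ^+ k))); last first.
  by move=> k _; rewrite exprS; ring.
rewrite sumrN telescope_sumr ?(ltnW mn) // opprB.
by rewrite gerBl exprn_ge0.
Qed.

(** Bounded terms at [z = 1 / 2] give [|a n| <= C * 2 ^+ n]; for small [z] the terms of positive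
    degree then cannot cancel [a 0]. *)
Lemma power_series_coef0_eq0 (R : realType) (a : nat -> R) :
  (forall z : R, 0 < z -> z < 1 ->
     \sum_(0 <= n < m) a n * z ^+ n @[m --> \oo] --> 0) ->
  a 0 = 0.
Proof.
move=> H; have h0 : 0 < (2^-1 : R) by rewrite invr_gt0.
have h1 : (2^-1 : R) < 1 by rewrite invf_lt1 // ltr1n.
have [C C0 HC] : exists2 C : R, 0 < C & forall k, `|a k| * 2^-1 ^+ k <= C.
  have cs : cvgn (series (fun k => a k * 2^-1 ^+ k)).
    by apply/cvg_ex; exists 0; exact: H.
  have [M M0 HM] := ex_strict_bound_gt0 (cvg_series_bounded cs).
  exists M => // k; apply: ltW.
  by have := HM k Logic.I; rewrite /= normrM (ger0_norm (exprn_ge0 _ (ltW h0))).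
apply/eqP; apply: contraT => a0; have {}a0 : 0 < `|a 0| by rewrite normr_gt0.
(* [z <= 1 / 4] keeps the ratio [2 * z] at most [1 / 2], so the terms of positive degree sum to at
   most [4 * C * z]; the second bound makes this at most [|a 0| / 2]. *)
pose z := Num.min 4^-1 (`|a 0| / (8 * C)).
have z0 : 0 < z by rewrite lt_min invr_gt0 ltr0n divr_gt0 // mulr_gt0.
have z4 : z <= 4^-1 by rewrite ge_min lexx.
have zC : 4 * C * z <= `|a 0| / 2.
  apply: (@le_trans _ _ (4 * C * (`|a 0| / (8 * C)))).
    by rewrite ler_wpM2l ?mulr_ge0 ?(ltW C0) // ge_min lexx orbT.
  by rewrite le_eqVlt; apply/orP; left; apply/eqP; field; rewrite gt_eqF.
have z1 : z < 1 by apply: le_lt_trans z4 _; rewrite invf_lt1 // ltr1n.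
have := cvgr_to_ge (cvg_norm (H z z0 z1)).
move=> /(_ _ (`|a 0| / 2) _); rewrite normr0.
suff Hn : \forall m \near \oo,
    `|a 0| / 2 <= `|\sum_(0 <= n < m) a n * z ^+ n|.
  by move=> /(_ Hn); rewrite leNgt divr_gt0.
near=> m; have m0 : (0 < m)%N by near: m; exact: nbhs_infty_gt.
rewrite big_ltn // expr0 mulr1.
have : `|\sum_(1 <= n < m) a n * z ^+ n| <= `|a 0| / 2.
  apply: le_trans zC; apply: le_trans (ler_norm_sum _ _ _) _.
  apply: (@le_trans _ _ (\sum_(1 <= n < m) C * (2 * z) ^+ n)).
    apply: ler_sum => n _; rewrite normrM (ger0_norm (exprn_ge0 _ (ltW z0))).
    rewrite exprMn mulrA ler_wpM2r ?exprn_ge0 ?(ltW z0) //.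
    by rewrite -ler_pdivrMr ?exprn_gt0 // -exprVn HC.
  rewrite -mulr_sumr; have z2 : 2 * z <= 2^-1 by lra.
  apply: (@le_trans _ _ (C * ((2 * z) ^+ 1 / (1 - 2 * z)))).
    by rewrite ler_wpM2l ?(ltW C0) // sum_geometric_le //; lra.
  have -> : 4 * C * z = C * (4 * z) by ring.
  rewrite expr1 ler_wpM2l ?(ltW C0) //.
  rewrite ler_pdivrMr; last lra.
  by nra.
set B := bigop _ _ _ => HB.
have := ler_normB (a 0 + B) B; rewrite addrK; lra.
Unshelve. all: by end_near.
Qed.

(** Once [a 0 = 0], dividing by [z] gives the same hypothesis for the shifted coefficients; the
    restriction to [z > 0] permits the division. *)
Lemma power_series_eq0 (R : realType) (a : nat -> R) :
  (forall z : R, 0 < z -> z < 1 ->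
     \sum_(0 <= n < m) a n * z ^+ n @[m --> \oo] --> 0) ->
  forall n, a n = 0.
Proof.
move=> H n; elim: n a H => [|n IH] a H; first exact: power_series_coef0_eq0 H.
apply: (IH (fun k => a k.+1)) => z z0 z1.
have a0 := power_series_coef0_eq0 H.
have Hz : (\sum_(0 <= k < m.+1) a k * z ^+ k) * z^-1 @[m --> \oo] --> 0 * z^-1.
  by apply: cvgMr_tmp; have := H z z0 z1; rewrite -cvg_shiftS.
rewrite mul0r in Hz; apply: cvg_trans Hz.
apply: near_eq_cvg; near=> m => /=.
rewrite big_nat_recl // a0 mul0r add0r mulr_suml; apply: eq_bigr => k _.
by rewrite exprS; field; rewrite gt_eqF.
Unshelve. all: by end_near.
Qed.

(** At [x = 0] the generating function is the geometric series [1 / (1 - z)]. *)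
Lemma meixner_at0 (R : realType) (q : R) (M : nat -> {poly R}) (n : nat) :
  meixner_family q M -> (M n).[0] = 1.
Proof.
move=> hM; apply/eqP; rewrite -subr_eq0; apply/eqP.
apply: (@power_series_eq0 R (fun k => (M k).[0] - 1)) => z z0 z1.
have z1' : `|z| < 1 by rewrite gtr0_norm.
have H0 := hM 0%N z z1'; rewrite expr0 mul1r expr1 in H0.
have H1 : \sum_(0 <= k < m) (M k).[0] * z ^+ k - series (geometric 1 z) m
    @[m --> \oo] --> (1 - z)^-1 - 1 * (1 - z)^-1.
  by apply: cvgB => //; exact: cvg_geometric_series.
rewrite mul1r subrr in H1.
apply: cvg_trans H1; apply: near_eq_cvg; near=> m.
rewrite /series /geometric /= -sumrB; apply: eq_bigr => k _.
by rewrite mulrBl.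
Unshelve. all: by end_near.
Qed.

(** The generating functions satisfy [(1 - z) G_(x+1) = (1 - z / q) G_x]; this compares the
    coefficients of [z ^+ n.+1]. *)
Lemma meixner_step (R : realType) (q : R) (M : nat -> {poly R}) (n x : nat) :
  meixner_family q M ->
  (M n.+1).[x.+1%:R] - (M n).[x.+1%:R] =
  (M n.+1).[x%:R] - q^-1 * (M n).[x%:R].
Proof.
move=> hM; apply/eqP; rewrite -subr_eq0; apply/eqP.
pose a k := ((M k).[x.+1%:R] - (M k).[x%:R]) -
  (if k is k'.+1 then (M k').[x.+1%:R] - q^-1 * (M k').[x%:R] else 0).
suff /(_ n.+1) : forall k, a k = 0.
  by rewrite /a => <-; ring.
apply: power_series_eq0 => z z0 z1.
have z1' : `|z| < 1 by rewrite gtr0_norm.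
have zn0 : 1 - z != 0 by rewrite subr_eq0 gt_eqF.
have H1 := hM x.+1 z z1'; have H0 := hM x z z1'.
(* The second sum is one term shorter, so that [u1 m - u0 m] is exactly a partial sum of the series
   of [a]. *)
pose u1 (m : nat) := \sum_(0 <= k < m.+1) (M k).[x.+1%:R] * z ^+ k
    - z * \sum_(0 <= k < m) (M k).[x.+1%:R] * z ^+ k.
pose u0 (m : nat) := \sum_(0 <= k < m.+1) (M k).[x%:R] * z ^+ k
    - q^-1 * z * \sum_(0 <= k < m) (M k).[x%:R] * z ^+ k.
have HL : u1 m - u0 m @[m --> \oo] -->
   ((1 - q^-1 * z) ^+ x.+1 * (1 - z) ^- x.+2
    - z * ((1 - q^-1 * z) ^+ x.+1 * (1 - z) ^- x.+2)) -
   ((1 - q^-1 * z) ^+ x * (1 - z) ^- x.+1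
    - q^-1 * z * ((1 - q^-1 * z) ^+ x * (1 - z) ^- x.+1)).
  apply: cvgB; apply: cvgB; try exact: cvgMl_tmp.
    by rewrite -cvg_shiftS in H1.
  by rewrite -cvg_shiftS in H0.
move: HL; set L := (X in _ --> X) => HL.
have L0 : L = 0.
  rewrite /L !exprS; move: (q^-1) => c; field.
  by rewrite zn0 expf_neq0.
rewrite {}L0 in HL.
rewrite -cvg_shiftS; apply: cvg_trans HL; apply: near_eq_cvg; near=> m => /=.
rewrite [RHS]big_nat_recl // /u1 /u0 ![\sum_(0 <= _ < m.+1) _]big_nat_recl //.
rewrite [in RHS](eq_bigr (fun k =>
  ((M k.+1).[x.+1%:R] * z ^+ k.+1 - z * ((M k).[x.+1%:R] * z ^+ k)) -
  ((M k.+1).[x%:R] * z ^+ k.+1 - q^-1 * z * ((M k).[x%:R] * z ^+ k)))); last first.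
  by move=> k _; rewrite /a exprS; ring.
rewrite !sumrB -!mulr_sumr /a; ring.
Unshelve. all: by end_near.
Qed.

(** With [q = 1 - p], one has [1 - 1 / q = - p / q], so by [meixner_step] the increments in [x] of
    [M n.+1] and [M n] differ by [- p / q] times the value of [M n] at [x]. Both start from 1 at
    [x = 0]. *)
Lemma meixner_sum (R : realType) (p : R) (M : nat -> {poly R}) (n x : nat) :
  p != 1 -> meixner_family (1 - p) M ->
  (M n.+1).[x%:R] = (M n).[x%:R]
    - p / (1 - p) * \sum_(0 <= l < x) (M n).[l%:R].
Proof.
move=> p1 hM; elim: x => [|x IH].
  by rewrite big_geq // mulr0 subr0 !(meixner_at0 _ hM).
have := meixner_step n x hM; rewrite big_nat_recr //= IH.
move=> /eqP; rewrite subr_eq => /eqP ->.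
by field; rewrite subr_eq0 eq_sym.
Qed.

(** * Krawtchouk polynomials and sums over increasing tuples *)

(** A nonzero difference would have as many roots among the naturals as its size. *)
Lemma poly_horner_inj (R : numDomainType) (f g : {poly R}) :
  (forall z, f.[z] = g.[z]) -> f = g.
Proof.
move=> fg; apply/eqP; rewrite -subr_eq0; apply: contraT => h0.
pose rs : seq R := [seq i%:R | i <- iota 0 (size (f - g)%R)].
have : (size rs < size (f - g)%R)%N.
  apply: max_poly_roots => //.
    by apply/allP => _ /mapP[i _ ->]; rewrite rootE !hornerE fg subrr.
  by rewrite map_inj_uniq ?iota_uniq // => i j /eqP; rewrite eqr_nat => /eqP.
by rewrite size_map size_iota ltnn.
Qed.

(** A success contributes the factor [1 + (1 - p) * z] and a failure [1 - p * z], so the Krawtchouk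
    generating function is the product of the [1 + (b - p) * z]. *)
Lemma krawtchouk_elem_sym (R : realType) (p : R) (K : nat -> nat -> {poly R})
    (v : bitseq) (r : nat) :
  krawtchouk_family p K -> (r <= size v)%N ->
  r`!%:R^-1 * (K r (size v)).[(count id v)%:R] =
  elem_sym [seq (b : bool)%:R - p | b <- v] r.
Proof.
move=> hK rv; pose x := count id v; pose N := size v.
pose f := \poly_(n < N.+1) (n`!%:R^-1 * (K n N).[x%:R]).
have -> : r`!%:R^-1 * (K r (size v)).[(count id v)%:R] = f`_r.
  by rewrite coef_poly ltnS rv.
rewrite -coef_prod_elem_sym; 
suff -> : f = \prod_(y <- [seq (b : bool)%:R - p | b <- v]) (1 + y *: 'X) by [].
apply: poly_horner_inj => z.
rewrite horner_poly horner_prod big_map.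
transitivity (\sum_(0 <= n < N.+1) (K n N).[x%:R] * (z ^+ n / n`!%:R)).
  by rewrite big_mkord; apply: eq_bigr => n _; ring.
rewrite hK ?count_size // /x /N.
elim: v {rv f x N} => [|b v IH]; first by rewrite big_nil !expr0 mulr1.
rewrite big_cons -IH /= !hornerE; case: b => /=.
  by rewrite add1n subSS exprS; ring.
by rewrite add0n subSn ?count_size // exprS; ring.
Qed.

(* The newest entry comes first: [x j; ...; x 1].  Entry [0] is never used. *)
Fixpoint past (A : Type) (x : nat -> A) (j : nat) : seq A :=
  if j is j'.+1 then x j :: past x j' else [::].

Lemma map_past (A B : Type) (f : A -> B) (x : nat -> A) (j : nat) :
  map f (past x j) = past (f \o x) j.
Proof. by elim: j => //= j ->. Qed.

Lemma size_past (A : Type) (x : nat -> A) (j : nat) : size (past x j) = j.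
Proof. by elim: j => //= j ->. Qed.

Lemma past_const (A : Type) (a : A) (j : nat) : past (fun=> a) j = nseq j a.
Proof. by elim: j => //= j ->. Qed.

Lemma big_past (R A : Type) (idx : R) (op : Monoid.com_law idx) (x : nat -> A)
    (F : A -> R) (j : nat) :
  \big[op/idx]_(a <- past x j) F a = \big[op/idx]_(1 <= i < j.+1) F (x i).
Proof.
elim: j => [|j IH] /=; first by rewrite big_nil big_geq.
by rewrite big_cons big_nat_recr //= IH Monoid.mulmC.
Qed.

Lemma count_past (x : nat -> bool) (j : nat) :
  count id (past x j) = (\sum_(1 <= i < j.+1) x i)%N.
Proof.
elim: j => [|j IH] /=; first by rewrite big_geq.
by rewrite big_nat_recr //= IH addnC.
Qed.

Lemma mem_past (A : eqType) (x : nat -> A) (j : nat) (a : A) :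
  a \in past x j -> exists2 i, (0 < i <= j)%N & a = x i.
Proof.
elim: j => [|j IH] //=; rewrite inE => /predU1P[->|/IH[i ij ->]].
  by exists j.+1; rewrite ?leqnn.
exists i => //.
by case/andP: ij => -> /leqW ->.
Qed.

(** Split by whether the largest allowed index occurs; if it does, it is the last entry, hence
    [rcons]. *)
Fixpoint incr_seqs (r L : nat) : seq (seq nat) :=
  match L, r with
  | _, 0 => [:: [::]]
  | 0, _.+1 => [::]
  | L'.+1, r'.+1 => incr_seqs r L' ++ [seq rcons t L | t <- incr_seqs r' L']
  end.

Lemma mem_incr_seqs (r L : nat) (t : seq nat) :
  (t \in incr_seqs r L) = [&& size t == r, path ltn 0 t & (last 0 t <= L)%N].
Proof.
elim: L r t => [|L IH] [|r] t.
- by rewrite inE; case: t.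
- by rewrite in_nil; case/lastP: t => // t [|a]; rewrite ?rcons_path last_rcons;
    rewrite /= ?ltn0 ?andbF.
- by rewrite inE; case: t.
rewrite /= mem_cat IH; case/lastP: t => [|t a]; first by case: mapP => // -[[]].
have -> : (rcons t a \in [seq rcons u L.+1 | u <- incr_seqs r L]) =
    (a == L.+1) && (t \in incr_seqs r L).
  apply/mapP/andP => [[u ur /rcons_inj[-> ->]]|[/eqP -> tr]]; last by exists t.
  by rewrite eqxx.
rewrite IH size_rcons eqSS rcons_path last_rcons.
case: (size t == r) => //=; case: (path ltn 0%N t) => /=; rewrite ?andbF //.
move: (last 0%N t) => l; apply/idP/idP => [/orP[]|]; last case: (eqVneq a L.+1);
  lia.
Qed.

Lemma uniq_incr_seqs (r L : nat) : uniq (incr_seqs r L).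
Proof.
elim: L r => [|L IH] [|r] //=.
rewrite cat_uniq IH map_inj_uniq ?IH ?andbT => [|? ? /rcons_inj[]] //.
apply/hasPn => _ /mapP[t _ ->]; rewrite /= mem_incr_seqs last_rcons.
by rewrite ltnn !andbF.
Qed.

Lemma sum_incr_seqs_prod (R : comNzRingType) (x : nat -> R) (r L : nat) :
  \sum_(t <- incr_seqs r L) \prod_(i <- t) x i = elem_sym (past x L) r.
Proof.
elim: L r => [|L IH] [|r] /=; rewrite ?big_seq1 ?big_nil //.
rewrite big_cat /= big_map !IH; congr (_ + _); rewrite -IH mulr_sumr.
by apply: eq_bigr => t _; rewrite -cats1 big_cat big_seq1 /= mulrC.
Qed.

(** Grouping by the largest index [j.+1] leaves [r] increasing indices in [1, ..., j], whose
    products sum to an elementary symmetric polynomial. *)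
Lemma sum_incr_seqs_last (R : comNzRingType) (x c : nat -> R) (r L : nat) :
  \sum_(t <- incr_seqs r.+1 L) (\prod_(i <- t) x i) * c (last 0 t) =
  \sum_(0 <= j < L) x j.+1 * c j.+1 * elem_sym (past x j) r.
Proof.
elim: L => [|L IH] /=; first by rewrite big_nil big_geq.
rewrite big_cat /= big_map IH [in RHS]big_nat_recr //=; congr (_ + _).
rewrite -sum_incr_seqs_prod mulr_sumr; apply: eq_bigr => t _.
by rewrite last_rcons -cats1 big_cat big_seq1 /=; ring.
Qed.

Lemma big_mem_subset (R : nmodType) (A : eqType) (s t : seq A) (F : A -> R) :
  uniq s -> uniq t -> {subset s <= t} ->
  \sum_(a <- t | a \in s) F a = \sum_(a <- s) F a.
Proof.
move=> us ut st; rewrite -big_filter; apply: perm_big.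
apply: uniq_perm => //; first exact: filter_uniq.
move=> a; rewrite mem_filter andb_idr //; exact: st.
Qed.

Lemma incr_seqs_enum (r L : nat) :
  exists2 e : seq (incr_tuple r), uniq e & 
    [seq val (val t) | t <- e] = incr_seqs r L.
Proof.
pose f (s : seq nat) : option (incr_tuple r) :=
  if (insub s : option (r.-tuple nat)) is Some t then insub t else None.
have fK l : all (fun s => s \in incr_seqs r L) l ->
    [seq val (val t) | t <- pmap f l] = l.
  elim: l => [//|s l IH] /= /andP[sr /IH {}IH].
  move: sr; rewrite mem_incr_seqs /f => /and3P[sr sp _].
  by rewrite insubT /= insubT /= IH.
pose e := pmap f (incr_seqs r L).
have eE : [seq val (val t) | t <- e] = incr_seqs r L by apply: fK; exact/allP.
exists e => //; have := uniq_incr_seqs r L; rewrite -eE; exact: map_uniq.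
Qed.

(** Absolute convergence: the sum over a finite [J] containing all tuples with indices up to [L]
    differs from the partial sum [U L] by at most the tail of [V], the series of absolute values. *)
Lemma has_sum_incr_tuple (R : realType) (x c : nat -> R) (r : nat) :
  cvgn (series (fun j => `|x j.+1 * c j.+1| * elem_sym (past (Num.norm \o x) j) r)) ->
  has_sum (fun t : incr_tuple r.+1 => (\prod_(i <- val t) x i) * c (max_index t))
    (limn (series (fun j => x j.+1 * c j.+1 * elem_sym (past x j) r))).
Proof.
pose F (t : seq nat) : R := (\prod_(i <- t) x i) * c (last 0%N t).
pose U : nat -> R := series (fun j => x j.+1 * c j.+1 * elem_sym (past x j) r).
pose V : nat -> R := series (fun j => `|x j.+1 * c j.+1| * elem_sym (past (Num.norm \o x) j) r).
move=> cV.
have UE L : U L = \sum_(t <- incr_seqs r.+1 L) F t.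
  by rewrite /U /series /= sum_incr_seqs_last.
have VE L : V L = \sum_(t <- incr_seqs r.+1 L) `|F t|.
  under eq_bigr do rewrite normrM normr_prod.
  rewrite (sum_incr_seqs_last (Num.norm \o x) (Num.norm \o c)).
  by rewrite /V /series /=; apply: eq_bigr => j _; rewrite normrM.
have elem_sym_norm j : `|elem_sym (past x j) r| <= elem_sym (past (Num.norm \o x) j) r.
  rewrite -!sum_incr_seqs_prod; apply: le_trans (ler_norm_sum _ _ _) _.
  by apply: ler_sum => t _; rewrite normr_prod.
have cU : cvgn U.
  apply: normed_cvg; apply: series_le_cvg cV => //= j.
    by rewrite mulr_ge0 // (le_trans _ (elem_sym_norm j)).
  by rewrite normrM ler_wpM2l.
have Vinc : nondecreasing_seq V.
  apply: nondecreasing_series => j _ _.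
  by rewrite mulr_ge0 // (le_trans _ (elem_sym_norm j)).
have FF : ProperFilter (@totally (incr_tuple r.+1)) by exact: totally_filter.
rewrite /has_sum; apply/cvgrPdist_le => e e0; rewrite -/U.
have [L LU LV] : exists2 L, `|limn U - U L| <= e / 2 & limn V - V L <= e / 2.
  have e2 : 0 < e / 2 by rewrite divr_gt0.
  have /cvgrPdist_le /(_ _ e2) HU : U @ \oo --> limn U by exact: cU.
  have /cvgrPdist_le /(_ _ e2) HV : V @ \oo --> limn V by exact: cV.
  near \oo => L; exists L; first by near: L; exact: HU.
  apply: le_trans (ler_norm _) _; near: L; exact: HV.
have [E uE EE] := incr_seqs_enum r.+1 L.
exists [fset t in E]%fset => // J /= EJ.
pose l := [seq val (val t) | t <- enum_fset J].
have ul : uniq l.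
  rewrite map_inj_uniq ?fset_uniq // => t u tu.
  by apply: val_inj; apply: val_inj.
have -> : partial_sum (fun t : incr_tuple r.+1 =>
    (\prod_(i <- val t) x i) * c (max_index t)) J = \sum_(t <- l) F t.
  by rewrite /partial_sum /l big_map big_seq_fsetE.
have lsub : {subset incr_seqs r.+1 L <= l}.
  move=> t; rewrite -EE => /mapP[u uE' ->]; apply: map_f.
  by apply: (fsubsetP EJ); rewrite inE.
(* Being finite, [l] lies among the tuples with indices up to some [L']; its part beyond [L] is then
   bounded by [V L' - V L]. *)
have [L' LL' lL'] : exists2 L', (L <= L')%N & {subset l <= incr_seqs r.+1 L'}.
  exists (maxn L (\max_(t <- l) last 0%N t)); first exact: leq_maxl.
  move=> t tl; rewrite mem_incr_seqs; apply/and3P; split.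
  - by case/mapP: tl => u _ ->; rewrite size_tuple.
  - by case/mapP: tl => u _ ->; exact: (valP u).
  - by rewrite leq_max (@leq_bigmax_seq _ _ xpredT (last 0%N) t tl isT) // orbT.
rewrite (bigID (mem (incr_seqs r.+1 L))) /= big_mem_subset //; last exact: uniq_incr_seqs.
rewrite -UE opprD addrA; apply: le_trans (ler_normB _ _) _.
rewrite [e]splitr lerD //; apply: le_trans (ler_norm_sum _ _ _) _.
apply: le_trans LV; apply: (@le_trans _ _ (V L' - V L)); last first.
  by rewrite lerD2r; exact: nondecreasing_cvgn_le.
have -> : V L' - V L = \sum_(t <- incr_seqs r.+1 L' | t \notin incr_seqs r.+1 L) `|F t|.
  rewrite !VE [X in X - _](bigID (mem (incr_seqs r.+1 L))) /= big_mem_subset ?uniq_incr_seqs //.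
    by rewrite addrAC subrr add0r.
  by move=> t /lsub /lL'.
rewrite [leRHS](bigID (mem l)) /= -[leLHS]addr0 lerD //; last exact: sumr_ge0.
rewrite [leLHS]big_mkcond /=.
rewrite -(big_mem_subset _ ul (uniq_incr_seqs r.+1 L') lL') -big_mkcondr /=.
by rewrite le_eqVlt; apply/orP; left; apply/eqP/eq_bigl => t; rewrite andbC.
Unshelve. all: by end_near.
Qed.

(** * The pathwise expansion *)

Section chaos.
Variables (R : realType) (p : R) (g : nat -> R) (b : nat -> bool).
Local Notation q := (1 - p).

(* [chaos_term r j] is the contribution of the tuples of [r + 1] indices whose
   largest index is [j + 1], and [chaos_rest m j] that of the tuples of more
   than [m] indices with this largest index; [g] is [M_(n-1)]. *)
Definition chaos_weight (j : nat) : R :=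
  ((b j.+1)%:R - p) * (q^-1 * q ^+ j * g j).

Definition chaos_term (r j : nat) : R :=
  chaos_weight j * elem_sym (map (bit_ratio p) (past b j)) r.

Definition chaos_rest (m j : nat) : R :=
  chaos_weight j * elem_sym_tail m (map (bit_ratio p) (past b j)).

Definition chaos_sum (r : nat) : R := limn (series (chaos_term r)).

(** [D] collects the constants. Averaging the squared tail will cost a factor [q ^- j], which leaves
    the ratio [q / s ^+ 3]. *)
Definition chaos_bound (s D : R) (m j : nat) : R :=
  D * (q ^+ 2 / s ^+ 3) ^+ j *
    elem_sym_tail m (map (bit_ratio p) (past b j)) ^+ 2.

Hypotheses (hp0 : 0 < p) (hp1 : p < 1).

Let q0 : 0 < q. Proof. by rewrite subr_gt0. Qed.
Let qn0 : q != 0. Proof. exact: lt0r_neq0. Qed.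

Lemma norm_bit_sub_le1 (a : bool) : `|a%:R - p| <= 1.
Proof.
case: a; first by rewrite mulr1n (ger0_norm (ltW q0)) gerBl ltW.
by rewrite sub0r normrN gtr0_norm // ltW.
Qed.

Lemma bit_ratioE (a : bool) : bit_ratio p a = - q^-1 * (a%:R - p).
Proof. by case: a; rewrite /bit_ratio /=; field. Qed.

(** Homogeneity extracts [(- 1 / q) ^+ r] from [y = - x / q]; this is the source of the alternating
    sign and of the negative power of [q] in the representation. *)
Lemma chaos_termE (r j : nat) : chaos_term r j =
  ((b j.+1)%:R - p) * ((- q^-1) ^+ r * (q^-1 * q ^+ j * g j)) *
    elem_sym (past (fun i => (b i)%:R - p) j) r.
Proof.
rewrite /chaos_term /chaos_weight map_past.
have -> : past (bit_ratio p \o b) j =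
    [seq - q^-1 * y | y <- past (fun i => (b i)%:R - p) j].
  by rewrite map_past; elim: j => //= j ->; rewrite bit_ratioE.
by rewrite elem_sym_scale; ring.
Qed.

Lemma chaos_term_rest (m j : nat) :
  chaos_rest m.+1 j = chaos_rest m j - chaos_term m j.
Proof.
by rewrite /chaos_rest /elem_sym_tail big_nat_recr //= /chaos_term; ring.
Qed.

(** * Pathwise convergence under a growth bound on [g] *)

Section convergence.
Variables (s C : R).
Hypotheses (s0 : 0 < s) (s1 : s < 1) (qs : q < s ^+ 3) (C0 : 0 <= C).
Hypothesis gle : forall j, `|g j| <= C * s ^- j.

Let th0 : 0 <= q / s ^+ 3. Proof. by rewrite divr_ge0 ?exprn_ge0 ?ltW. Qed.
Let th1 : q / s ^+ 3 < 1. Proof. by rewrite ltr_pdivrMr ?exprn_gt0 // mul1r. Qed.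

(** With [c = 1 / s] the symmetric polynomial is of order [s ^- j], and so is [g j], which gives the
    ratio [q / s ^+ 2]. *)
Lemma cvg_elem_sym_series (y : nat -> R) (r : nat) :
  (forall i, `|y i| <= 1) ->
  cvgn (series (fun j =>
    `|(- q^-1) ^+ r * (q^-1 * q ^+ j * g j)| * `|elem_sym (past y j) r|)).
Proof.
move=> y1; pose c := s^-1.
have c1 : 1 < c by rewrite invf_gt1.
have cr0 : 0 < (c - 1) ^+ r by rewrite exprn_gt0 // subr_gt0.
pose k := `|(- q^-1) ^+ r|; pose D := k * q^-1 * C * (c - 1) ^- r.
have D0 : 0 <= D by rewrite !mulr_ge0 ?normr_ge0 ?invr_ge0 ?(ltW q0) ?(ltW cr0).
apply: (@series_le_cvg _ _ (geometric D (q / s ^+ 3))) => [j|j|j|].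
- by rewrite mulr_ge0.
- by rewrite mulr_ge0 // exprn_ge0.
- have He : `|elem_sym (past y j) r| <= (c - 1) ^- r * c ^+ j.
    rewrite ler_pdivlMl // -{2}(size_past y j); apply: norm_elem_sym_le.
      exact: ltW.
    by move=> _ /mem_past[i _ ->].
  have Hg : `|(- q^-1) ^+ r * (q^-1 * q ^+ j * g j)| <=
      k * (q^-1 * q ^+ j * (C * s ^- j)).
    have qj0 : 0 <= q^-1 * q ^+ j by rewrite mulr_ge0 ?invr_ge0 ?exprn_ge0 ?(ltW q0).
    by rewrite normrM ler_wpM2l // normrM (ger0_norm qj0) ler_wpM2l.
  apply: le_trans (ler_pM (normr_ge0 _) (normr_ge0 _) Hg He) _.
  have -> : k * (q^-1 * q ^+ j * (C * s ^- j)) * ((c - 1) ^- r * c ^+ j) =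
    D * (q ^+ j * s ^- (2 * j)).
    rewrite /D /c exprVn [(2 * j)%N]mulnC exprM expr2 invfM.
    by move: (s ^- j) ((_ - 1) ^- r) => u v; ring.
  (* The ratio is weakened from [q / s ^+ 2] to [q / s ^+ 3], already known to be below 1. *)
  rewrite /geometric /= ler_wpM2l // exprMn ler_wpM2l ?exprn_ge0 ?(ltW q0) //.
  rewrite exprVn -exprM lef_pV2 ?posrE ?exprn_gt0 //.
  by apply: ler_wiXn2l; rewrite ?(ltW s0) ?(ltW s1) // leq_mul2r orbT.
- by apply: is_cvg_geometric_series; rewrite ger0_norm.
Qed.

Lemma cvg_chaos_term (r : nat) : cvgn (series (chaos_term r)).
Proof.
apply: normed_cvg.
have := @cvg_elem_sym_series (fun i => (b i)%:R - p) r (fun i => norm_bit_sub_le1 (b i)).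
apply: series_le_cvg => j; rewrite /= ?mulr_ge0 //.
by rewrite chaos_termE !normrM -!mulrA ler_piMl ?norm_bit_sub_le1 // !mulr_ge0.
Qed.

Lemma has_sum_chaos (r : nat) :
  has_sum (fun t : incr_tuple r.+1 =>
      (\prod_(i <- val t) ((b i)%:R - p)) *
      ((- q^-1) ^+ r * (q^-1 * q ^+ (max_index t).-1 * g (max_index t).-1)))
    (chaos_sum r).
Proof.
have -> : chaos_sum r = limn (series (fun j => ((b j.+1)%:R - p) *
  ((- q^-1) ^+ r * (q^-1 * q ^+ j.+1.-1 * g j.+1.-1)) *
  elem_sym (past (fun i => (b i)%:R - p) j) r)).
  by rewrite /chaos_sum; congr (limn (series _)); apply/funext => j; rewrite chaos_termE.
apply: (@has_sum_incr_tuple R (fun i => (b i)%:R - p)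
  (fun i => (- q^-1) ^+ r * (q^-1 * q ^+ i.-1 * g i.-1)) r).
have H i : `|(Num.norm \o (fun i => (b i)%:R - p)) i| <= 1.
  by rewrite /= normr_id norm_bit_sub_le1.
have := @cvg_elem_sym_series _ r H.
have En0 j : 0 <= elem_sym (past (Num.norm \o (fun i => (b i)%:R - p)) j) r.
  rewrite -sum_incr_seqs_prod; apply: sumr_ge0 => t _.
  by apply: prodr_ge0 => i _ /=.
apply: series_le_cvg => j; rewrite /= ?mulr_ge0 //.
rewrite (ger0_norm (En0 j)) !normrM -!mulrA ler_piMl ?norm_bit_sub_le1 //.
by rewrite !mulr_ge0.
Qed.

(** Only finitely many orders are removed, so the convergent series of [chaos_term r] can be
    subtracted one at a time. *)
Lemma cvg_chaos_rest (l : R) (m : nat) :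
  series (chaos_rest 0) @ \oo --> l ->
  series (chaos_rest m) @ \oo --> l - \sum_(0 <= r < m) chaos_sum r.
Proof.
move=> H; elim: m => [|m IH]; first by rewrite big_geq // subr0.
rewrite big_nat_recr //= opprD addrA.
have -> : series (chaos_rest m.+1) =
    (fun N => series (chaos_rest m) N - series (chaos_term m) N).
  apply/funext => N; rewrite /series /= -sumrB; apply: eq_bigr => j _.
  by rewrite chaos_term_rest.
by apply: cvgB => //; exact: cvg_chaos_term.
Qed.

(** [sqr_sum_le_weighted] bounds each squared partial sum of [chaos_rest m], and the bound passes to
    the limit. The right side is extended real, since no convergence is claimed for it. *)
Lemma chaos_residual_le (l : R) (m : nat) :
  series (chaos_rest 0) @ \oo --> l ->
  (((l - \sum_(0 <= r < m) chaos_sum r) ^+ 2)%:E <=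
   \sum_(j <oo) (chaos_bound s ((1 - s)^-1 * q ^- 2 * C ^+ 2) m j)%:E)%E.
Proof.
move=> /(@cvg_chaos_rest l m) H.
have t0 : 0 < 1 - s by rewrite subr_gt0.
set D := _ * C ^+ 2.
have D0 : 0 <= D.
  by rewrite !mulr_ge0 ?invr_ge0 ?exprn_ge0 ?(ltW q0) ?(ltW t0).
have B0 j : 0 <= chaos_bound s D m j.
  have K0 : 0 <= q ^+ 2 / s ^+ 3.
    by rewrite divr_ge0 ?exprn_ge0 ?(ltW q0) ?(ltW s0).
  by rewrite /chaos_bound mulr_ge0 ?sqr_ge0 // mulr_ge0 // exprn_ge0.
have HN N : (series (chaos_rest m) N) ^+ 2 <= \sum_(0 <= j < N) chaos_bound s D m j.
  apply: le_trans (sqr_sum_le_weighted _ _ s0 s1) _.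
  rewrite mulr_sumr; apply: ler_sum => j _.
  rewrite /chaos_rest /chaos_weight /chaos_bound.
  have q2 : q ^- 2 = q^-1 ^+ 2 by rewrite exprVn.
  set e := elem_sym_tail _ _; set a := (b j.+1)%:R - p.
  (* Isolates [a ^+ 2] and [g j ^+ 2], the two factors to be estimated. *)
  have -> : (1 - s)^-1 * (s ^- j * (a * (q^-1 * q ^+ j * g j) * e) ^+ 2) =
     ((1 - s)^-1 * q^- 2 * e ^+ 2 * (q ^+ j) ^+ 2 * s ^- j) * (a ^+ 2 * g j ^+ 2).
    by rewrite q2; move: (s ^- j) => u; ring.
  have -> : D * (q ^+ 2 / s ^+ 3) ^+ j * e ^+ 2 =
     ((1 - s)^-1 * q^- 2 * e ^+ 2 * (q ^+ j) ^+ 2 * s ^- j) * (1 * (C * s ^- j) ^+ 2).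
    have -> : (q ^+ 2 / s ^+ 3) ^+ j = (q ^+ j) ^+ 2 * (s ^- j) ^+ 3.
      by rewrite expr_div_n -!exprM mulnC [in RHS]exprVn -exprM [(j * 3)%N]mulnC.
    by rewrite /D q2; move: (s ^- j) => u; ring.
  rewrite ler_wpM2l //.
    move: (sqr_ge0 e) (sqr_ge0 (q ^+ j)); move: (e ^+ 2) ((q ^+ j) ^+ 2) => u v.
    by move=> u0 v0; rewrite !mulr_ge0 ?invr_ge0 ?exprn_ge0 ?(ltW q0) ?(ltW t0) ?(ltW s0).
  apply: ler_pM; rewrite ?sqr_ge0 //.
    by rewrite -[a ^+ 2]real_normK ?num_real // exprn_ile1 // norm_bit_sub_le1.
  rewrite -[g j ^+ 2]real_normK ?num_real //.
  by rewrite ler_sqr ?nnegrE // mulr_ge0 // invr_ge0 exprn_ge0 // ltW.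
set S := (\sum_(j <oo) _)%E.
have SN N : ((\sum_(0 <= j < N) chaos_bound s D m j)%:E <= S)%E.
  rewrite -sumEFin; apply: nneseries_lim_ge => j _ _; by rewrite lee_fin.
have : forall N, (((series (chaos_rest m) N) ^+ 2)%:E <= S)%E.
  by move=> N; apply: le_trans (SN N); rewrite lee_fin.
case: S {SN} => [S| |] HS; last 2 first.
- by rewrite leey.
- by have := HS 0%N.
rewrite lee_fin.
have H2 : (series (chaos_rest m) N) ^+ 2 @[N --> \oo] -->
    (l - \sum_(0 <= r < m) chaos_sum r) ^+ 2.
  by rewrite expr2; under eq_fun do rewrite expr2; exact: cvgM.
apply: (cvgr_to_le H2); near=> N; rewrite -lee_fin; exact: HS.
Unshelve. all: by end_near.
Qed.

End convergence.

(** Before the first success each factor is [1 / q], so the product cancels [q ^+ j]; from the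
    success on, one factor is 0. The index [k] yields [g k], and each smaller [j] yields
    [- p / q * g j]. *)
Lemma sum_chaos_rest0 (k N : nat) :
  (forall i, (0 < i <= k)%N -> b i = false) -> b k.+1 -> (k < N)%N ->
  \sum_(0 <= j < N) chaos_rest 0 j =
    g k - p / q * \sum_(0 <= l < k) g l.
Proof.
move=> b0 b1 kN.
have restE j : chaos_rest 0 j = chaos_weight j *
    \prod_(a <- past b j) (1 + bit_ratio p a).
  by rewrite /chaos_rest /elem_sym_tail big_geq // subr0 big_map.
have prodE j : (j <= k)%N -> \prod_(a <- past b j) (1 + bit_ratio p a) = q ^- j.
  elim: j => [|j IH] jk; first by rewrite big_nil expr0 invr1.
  rewrite /= big_cons IH ?(ltnW jk) // b0 // /bit_ratio exprS.
  by field; rewrite expf_neq0.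
rewrite (big_cat_nat (n := k.+1)) //= [X in _ + X]big1_seq ?addr0; last first.
  move=> j /andP[_]; rewrite mem_index_iota => /andP[kj _].
  rewrite restE -[j](subnK kj) addnC; elim: (j - k.+1)%N => [|i IH].
    by rewrite addn0 /= big_cons b1 /bit_ratio subrr mul0r mulr0.
  rewrite addnS /= big_cons mulrCA.
  have : \prod_(a <- past b (k.+1 + i)) (1 + bit_ratio p a) = 0.
    elim: i {IH} => [|i IH]; first by rewrite addn0 /= big_cons b1 /bit_ratio subrr mul0r.
    by rewrite addnS /= big_cons IH mulr0.
  by move=> ->; rewrite !mulr0.
rewrite big_nat_recr //= addrC; congr (_ + _).
  rewrite restE prodE // /chaos_weight b1 /=.
  by field; rewrite expf_neq0.
rewrite mulr_sumr -sumrN !big_nat; apply: eq_bigr => j /andP[_ jk].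
rewrite restE prodE ?(ltnW jk) // /chaos_weight b0 //=.
by field; rewrite ?expf_neq0 ?qn0.
Qed.

End chaos.

(** * Bernoulli trials *)

(** Cauchy criterion, with tolerances [1 / (k + 1)] to keep the intersections countable. *)
Lemma measurable_cvgn_set (d : measure_display) (T : measurableType d)
    (R : realType) (h : nat -> T -> R) :
  (forall m, measurable_fun setT (h m)) ->
  measurable [set x | cvgn (h ^~ x)].
Proof.
move=> mh.
have -> : [set x | cvgn (h ^~ x)] = \bigcap_k \bigcup_N
    \bigcap_(m in [set m | (N <= m)%N]) \bigcap_(n in [set n | (N <= n)%N])
      ((fun x => `|h m x - h n x|) @^-1` `]-oo, k.+1%:R^-1[).
  apply/seteqP; split => [x /= cx k _ | x /= Hx].
    have k0 : 0 < k.+1%:R^-1 / 2 :> R by rewrite divr_gt0 // invr_gt0.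
    have /cvgrPdist_lt /(_ _ k0) [N _ HN] : h ^~ x @ \oo --> limn (h ^~ x) by exact: cx.
    exists N => // m /= Nm n /= Nn; rewrite in_itv /=.
    have Hm := HN m Nm; have Hn := HN n Nn; rewrite /= in Hm Hn.
    rewrite -(subrKA (limn (h ^~ x))); apply: le_lt_trans (ler_normD _ _) _.
    by rewrite [ltRHS]splitr ltrD // distrC.
  apply/cauchy_cvgP/cauchy_ballP => e e0; rewrite near_map2.
  have [k _ ke] := near_infty_natSinv_lt (PosNum e0).
  have [N _ HN] := Hx k I.
  exists ([set m | (N <= m)%N], [set m | (N <= m)%N]); first by split; exists N.
  move=> [m n] /= [Nm Nn]; have := HN m Nm n Nn; rewrite /= in_itv /=.
  by rewrite /ball /= => H; apply: lt_trans H _; exact: (ke k (leqnn _)).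
apply: bigcapT_measurable => k; apply: bigcupT_measurable => N.
apply: bigcap_measurable => [|m _]; first by exists N => /=.
apply: bigcap_measurable => [|n _]; first by exists N => /=.
rewrite -[X in measurable X]setTI.
have : measurable_fun setT (fun x => `|h m x - h n x|).
  by apply: measurableT_comp => //; exact: measurable_funB.
by apply.
Qed.

(** Where the sequence diverges, [lim] has the constant value [point], so the two pieces are
    measurable separately. *)
Lemma measurable_fun_limn (d : measure_display) (T : measurableType d)
    (R : realType) (h : nat -> T -> R) :
  (forall m, measurable_fun setT (h m)) ->
  measurable_fun setT (fun x => limn (h ^~ x)).
Proof.
move=> mh; have mD := measurable_cvgn_set mh; set D := [set x | _] in mD.
rewrite -(setUv D); apply/measurable_funU => //; first exact: measurableC.
split.
  apply: (@measurable_fun_cvg _ _ _ _ h) => // m.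
  exact: measurable_funS (mh m).
apply: (@eq_measurable_fun _ _ _ _ _ (cst point)) => [x|].
  by rewrite inE => /dvgP ->.
exact: measurable_cst.
Qed.

Lemma past_eqP (A : Type) (x y : nat -> A) (j : nat) :
  past x j = past y j <-> forall i, (0 < i <= j)%N -> x i = y i.
Proof.
elim: j => [|j IH] /=; first by split => // _ i; case: i.
split=> [[xy /IH H] i ij|H].
  have [->//|ij'] := eqVneq i j.+1; apply: H; lia.
rewrite H ?leqnn //; congr (_ :: _); apply/IH => i /andP[i0 ij]; apply: H.
by rewrite i0 leqW.
Qed.

(** With the newest entry first, trial [i] sits at position [size v - i]. *)
Lemma past_nth (A : Type) (a : A) (v : seq A) :
  past (fun i => nth a v (size v - i)) (size v) = v.
Proof.
elim: v => //= x v IH; rewrite subnn /=; congr (_ :: _).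
rewrite -[RHS]IH; apply/past_eqP => i /andP[i0 iv].
by rewrite subSn.
Qed.

Section trials.
Context {d : measure_display} {T : measurableType d} {R : realType}.
Variables (P : probability T R) (xi : nat -> {RV P >-> R}).

(** Boolean at every [w], including those where [xi i w] is neither 0 nor 1. *)
Definition bits (w : T) (i : nat) : bool := xi i w == 1.

Let mxi1 (i : nat) : measurable (xi i @^-1` [set 1]).
Proof. by rewrite -[X in measurable X]setTI; exact: measurable_funPT. Qed.

Let mxi0 (i : nat) : measurable (xi i @^-1` [set 0]).
Proof. by rewrite -[X in measurable X]setTI; exact: measurable_funPT. Qed.

Lemma bitE (i : nat) (c : bool) : [set w | bits w i = c] =
  xi i @^-1` (if c then [set 1] else ~` [set 1]).
Proof.
apply/seteqP; split => w; rewrite /bits; case: c => /=.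
- by move/eqP.
- by move/eqP.
- by move=> ->; rewrite eqxx.
- by move/eqP/negbTE.
Qed.

(** Puts the cylinder in the form of the events in [independent_trials]. *)
Lemma past_bitsE (v : bitseq) : [set w | past (bits w) (size v) = v] =
  \bigcap_(i in [set` [fset i in iota 1 (size v)]%fset])
    (xi i @^-1` (if nth false v (size v - i) then [set 1] else ~` [set 1])).
Proof.
apply/seteqP; split => w /=.
  rewrite -{2}(past_nth false v) => /past_eqP H i /=.
  rewrite !inE mem_iota => /andP[i0 iv].
  have /(congr1 (fun X => X w)) /= <- := bitE i (nth false v (size v - i)).
  by apply: H; rewrite i0; lia.
move=> H; rewrite -[RHS](past_nth false v); apply/past_eqP => i /andP[i0 iv].
have /(congr1 (fun X => X w)) /= -> := bitE i (nth false v (size v - i)).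
apply: H => /=; rewrite !inE mem_iota; lia.
Qed.

Lemma measurable_past_bits (v : bitseq) :
  measurable [set w | past (bits w) (size v) = v].
Proof.
rewrite past_bitsE; apply: fin_bigcap_measurable; first exact: finite_fset.
move=> i _; case: ifP => _; first exact: mxi1.
by rewrite -preimage_setC; apply: measurableC.
Qed.

(** Writing a function of finitely many bits as a combination of indicators of cylinders reduces its
    measurability and its integral to those of cylinders. *)
Lemma past_bits_indic (F : bitseq -> R) (j : nat) (w : T) :
  F (past (bits w) j) = \sum_(v <- bitseqs j)
    F v * \1_[set w | past (bits w) (size v) = v] w.
Proof.
pose v := past (bits w) j.
have vj : v \in bitseqs j.
  by have := mem_bitseqs v; rewrite size_past.
rewrite (bigD1_seq v) ?uniq_bitseqs //= indicE mem_set /=; last first.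
  by rewrite size_past.
rewrite mulr1 big1_seq ?addr0 // => u /andP[uv uj].
rewrite indicE memNset ?mulr0 //= (size_bitseqs uj) => E.
by move: uv; rewrite -E eqxx.
Qed.

Lemma measurable_past_bits_fun (F : bitseq -> R) (j : nat) :
  measurable_fun setT (fun w => F (past (bits w) j)).
Proof.
under eq_fun do rewrite past_bits_indic.
apply: measurable_sum => v; apply: measurable_funM => //.
by apply: measurable_indic; exact: measurable_past_bits.
Qed.

Variable p : R.
Hypotheses (hp0 : 0 < p) (hp1 : p < 1) (hxi : bernoulli_trials p xi).

Lemma prob_past_bits (v : bitseq) :
  P [set w | past (bits w) (size v) = v] = (bit_weight p v)%:E.
Proof.
case: hxi => hP hI; rewrite past_bitsE hI; last 2 first.
- by move=> i; rewrite !inE mem_iota => /andP[].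
- by move=> i; case: ifP => _ //; exact: measurableC.
have -> : bit_weight p v =
    \prod_(1 <= i < (size v).+1) (if nth false v (size v - i) then p else 1 - p).
  by rewrite /bit_weight -{1}(past_nth false v) big_past.
rewrite -prodEFin.
rewrite (perm_big (index_iota 1 (size v).+1)) /=; last first.
  apply: uniq_perm; rewrite ?fset_uniq ?iota_uniq // => i.
  by rewrite !inE mem_iota /index_iota mem_iota subn1.
rewrite !big_nat; apply: eq_bigr => i /andP[i0 _]; case: ifP => _.
  by case: (hP i i0).
rewrite -preimage_setC probability_setC //; case: (hP i i0) => -> _.
by rewrite EFinB.
Qed.

Lemma integral_past_bits (F : bitseq -> R) (j : nat) :
  (forall v, 0 <= F v) ->
  (\int[P]_w (F (past (bits w) j))%:E =
   (\sum_(v <- bitseqs j) bit_weight p v * F v)%:E)%E.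
Proof.
move=> F0.
under eq_integral do rewrite past_bits_indic -sumEFin.
rewrite ge0_integral_sum //; last 2 first.
- move=> v; apply/measurable_EFinP; apply: measurable_funM => //.
  by apply: measurable_indic; exact: measurable_past_bits.
- by move=> v w _; rewrite lee_fin mulr_ge0.
rewrite -sumEFin; apply: eq_bigr => v _.
under eq_integral do rewrite EFinM.
rewrite ge0_integralZl_EFin //; last first.
  by apply/measurable_EFinP/measurable_indic; exact: measurable_past_bits.
rewrite integral_indic //; last exact: measurable_past_bits.
by rewrite setIT [X in (_ * X)%E]prob_past_bits -EFinM mulrC.
Qed.

(** For each trial the values 1 and 0 have total probability 1, and a countable union of null sets
    is null. *)
Lemma ae_bits : {ae P, forall w, forall i, (0 < i)%N -> xi i w = (bits w i)%:R}.
Proof.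
apply: ae_foralln => i; case: i => [|i]; first exact: aeW.
case: hxi => hP _; have [h1 h0] := hP i.+1 isT.
pose A := xi i.+1 @^-1` [set 1] `|` xi i.+1 @^-1` [set 0].
have mA : measurable A by exact: measurableU.
have PA : P A = 1%E.
  have -> : P A = (P (xi i.+1 @^-1` [set 1%R]) + P (xi i.+1 @^-1` [set 0%R]))%E.
    rewrite -measureU //.
    by apply/seteqP; split => // w /= [-> /eqP]; rewrite oner_eq0.
  by rewrite h1 h0 -EFinD addrC subrK.
exists (~` A); split; first exact: measurableC.
  by have := probability_setC P mA; rewrite PA subee.
move=> w /= H [E|E]; apply: H => _; rewrite /bits E ?eqxx //.
by rewrite eq_sym oner_eq0.
Qed.

(** A path without success lies in every [A j], and [P (A j) = (1 - p) ^+ j] tends to 0. *)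
Lemma ae_first_success : {ae P, forall w, exists k : nat,
  (forall i, (0 < i <= k)%N -> bits w i = false) /\ bits w k.+1}.
Proof.
pose A j := [set w | past (bits w) (size (nseq j false)) = nseq j false].
have mA j : measurable (A j) by exact: measurable_past_bits.
exists (\bigcap_j A j); split.
- exact: bigcapT_measurable.
- apply/eqP; rewrite eq_le measure_ge0 andbT; apply/lee_addgt0Pr => e e0.
  rewrite add0e.
  have q1 : `|1 - p| < 1.
    by rewrite gtr0_norm ?subr_gt0 // gtrBl.
  have /cvgrPdist_lt /(_ _ e0) [j _ Hj] := cvg_expr q1.
  apply: (@le_trans _ _ (P (A j))).
    apply: le_measure; rewrite ?inE //; first exact: bigcapT_measurable.
    by move=> w /(_ j); exact.
  rewrite prob_past_bits lee_fin /bit_weight big_nseq iter_mulr_1.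
  apply: ltW; apply: le_lt_trans (Hj j (leqnn j)).
  by rewrite sub0r normrN ler_norm.
move=> w /= H j _; rewrite /A /= size_nseq.
rewrite -past_const; apply/past_eqP => i /andP[i0 _]; apply/negbTE/negP => bi.
have ex : exists i, (0 < i)%N && bits w i by exists i; rewrite i0.
case: (ex_minnP ex) => -[//|k] /andP[_ bk] kmin; apply: H; exists k; split=> //.
move=> l /andP[l0 lk]; apply/negbTE/negP => bl.
by have := kmin l; rewrite l0 bl => /(_ isT); rewrite ltnNge lk.
Qed.

End trials.

(** * Convergence *)

Lemma cvg_sqr0 (R : realType) (u : nat -> R) (l : R) :
  (l - u m) ^+ 2 @[m --> \oo] --> 0 -> u @ \oo --> l.
Proof.
move=> /cvgrPdist_lt H; apply/cvgrPdist_lt => e e0.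
have e2 : 0 < e ^+ 2 by rewrite exprn_gt0.
have {}H := H _ e2; near=> m.
have : `|0 - (l - u m) ^+ 2| < e ^+ 2 by near: m.
rewrite sub0r normrN normrX ltr_pXn2r ?nnegrE //; exact: ltW.
Unshelve. all: by end_near.
Qed.

(** As [B] is summable, the sum of the [G m] has finite integral, hence is finite almost surely. The
    squared residuals then form a convergent series and tend to 0. Mean square convergence follows
    from [B m --> 0]. *)
Lemma rv_series_of_summable_bound (d : measure_display) (T : measurableType d)
    (R : realType) (P : probability T R) (S : nat -> {RV P >-> R}) (Y : T -> R)
    (G : nat -> T -> \bar R) (B : nat -> R) :
  measurable_fun setT Y ->
  (forall m, measurable_fun setT (G m)) ->
  (forall m w, (0 <= G m w)%E) ->
  {ae P, forall w, forall m,
     (((Y w - \sum_(1 <= r < m.+1) S r w) ^+ 2)%:E <= G m w)%E} ->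
  (forall m, (\int[P]_w G m w <= (B m)%:E)%E) ->
  cvgn (series B) ->
  rv_series S Y.
Proof.
move=> mY mG G0 aeG intG cB.
have B0 m : 0 <= B m.
  by rewrite -lee_fin; apply: le_trans (intG m); exact: integral_ge0.
have mSY m : measurable_fun setT (fun w => ((Y w - \sum_(1 <= r < m) S r w) ^+ 2)%:E).
  apply/measurable_EFinP; apply: measurable_funX; apply: measurable_funB => //.
  by apply: measurable_sum => r; exact: measurable_funP.
split.
  pose H w := (\sum_(m <oo) G m w)%E.
  have mH : measurable_fun setT H by exact: ge0_emeasurable_sum.
  have H0 w : (0 <= H w)%E by exact: nneseries_ge0.
  have iH : P.-integrable setT H.
    apply/integrableP; split => //.
    under eq_integral do rewrite gee0_abs //.
    rewrite /H integral_nneseries //.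
    apply: (@le_lt_trans _ _ (\sum_(m <oo) (B m)%:E)%E).
      by apply: lee_nneseries => [m _ _|m _]; [exact: integral_ge0|exact: intG].
    under eq_fun do rewrite sumEFin.
    by rewrite EFin_lim // ltry.
  have aeH := integrable_ae measurableT iH.
  apply: filterS2 aeG aeH => w Gw /(_ Logic.I) /fineK Hw.
  pose a m := (Y w - \sum_(1 <= r < m.+1) S r w) ^+ 2.
  have ca : cvgn (series a).
    apply: nondecreasing_is_cvgn.
      by apply: nondecreasing_series => m _ _; exact: sqr_ge0.
    exists (fine (H w)) => _ [n _ <-].
    rewrite -lee_fin Hw /series /= -sumEFin.
    apply: (@le_trans _ _ (\sum_(0 <= m < n) G m w)%E).
      by apply: lee_sum => m _; exact: Gw.
    by apply: nneseries_lim_ge.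
  rewrite -cvg_shiftS; apply: cvg_sqr0; exact: cvg_series_cvg_0 ca.
suff H : (\int[P]_w ((Y w - \sum_(1 <= r < m.+1) S r w) ^+ 2)%:E
    @[m --> \oo] --> 0)%E by rewrite -cvg_shiftS.
apply: (@squeeze_cvge _ _ _ _ (fun=> 0%E) _ (fun m => (B m)%:E)).
- near=> m; apply/andP; split.
    by apply: integral_ge0 => w _; rewrite lee_fin sqr_ge0.
  apply: le_trans (intG m); apply: ae_ge0_le_integral => //.
  + by move=> w _; rewrite lee_fin sqr_ge0.
  + by apply: filterS aeG => w Gw _; exact: Gw.
- exact: cvg_cst.
- by apply: cvg_EFin; [exact: nearW|exact: cvg_series_cvg_0 cB].
Unshelve. all: by end_near.
Qed.

(** * The number of failures before the first success *)

Section failures.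
Context {d : measure_display} {T : measurableType d} {R : realType}.
Variables (P : probability T R) (xi : nat -> {RV P >-> R}).

Lemma measurable_failures : measurable_fun setT (failures xi).
Proof.
apply: (measurable_fun_limn (h := failures_partial xi)) => m.
rewrite /failures_partial; apply: measurable_sum => j.
apply: measurable_funM; last exact: measurable_funP.
apply: measurable_funM => //; apply: measurable_prod => i _.
by apply: measurable_funB => //; exact: measurable_funP.
Qed.

(** Only [j = k.+1] can contribute: earlier terms have [xi j w = 0], later ones contain the factor
    [1 - xi k.+1 w = 0]. *)
Lemma cvg_failures_partial (w : T) (k : nat) :
  (forall i, (0 < i)%N -> (i <= k)%N -> xi i w = 0) -> xi k.+1 w = 1 ->
  failures_partial xi m w @[m --> \oo] --> (k%:R : R).
Proof.
move=> x0 x1; apply: cvg_near_cst; near=> m.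
have km : (k.+1 < m)%N by near: m; exact: nbhs_infty_gt.
rewrite /failures_partial (bigD1_seq k.+1) ?iota_uniq //=; last first.
  by rewrite mem_index_iota.
have -> : \prod_(1 <= i < k.+1) (1 - xi i w) = 1.
  apply: big1_seq => i /andP[_]; rewrite mem_index_iota => /andP[i0 ik].
  by rewrite x0 ?subr0.
rewrite x1 !mulr1 big1_seq ?addr0 //.
move=> j /andP[jk]; rewrite mem_index_iota => /andP[j0 _].
have [jk1|jk1] := ltnP j k.+1; first by rewrite x0 ?mulr0.
have kj : (k.+1 < j)%N by rewrite ltn_neqAle eq_sym jk.
rewrite (bigD1_seq k.+1) ?iota_uniq //=; last by rewrite mem_index_iota.
by rewrite x1 subrr mul0r mulr0 mul0r.
Unshelve. all: by end_near.
Qed.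

Variables (p : R).
Hypotheses (hp0 : 0 < p) (hp1 : p < 1) (hxi : bernoulli_trials p xi).

Lemma ae_failures : {ae P, forall w, exists k : nat,
  [/\ forall i, (0 < i)%N -> xi i w = (bits xi w i)%:R,
      forall i, (0 < i <= k)%N -> bits xi w i = false,
      bits xi w k.+1,
      failures_partial xi m w @[m --> \oo] --> (k%:R : R)
    & failures xi w = k%:R]}.
Proof.
apply: filterS2 (ae_bits hxi) (ae_first_success hp0 hp1 hxi).
move=> w xb [k [b0 b1]]; exists k.
have cf : failures_partial xi m w @[m --> \oo] --> (k%:R : R).
  apply: cvg_failures_partial => [i i0 ik|]; rewrite xb ?b1 ?b0 //.
  by rewrite i0.
by split => //; exact/cvg_lim.
Qed.

(** The event agrees almost surely with the cylinder of [x] failures followed by a success, written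
    newest first. *)
Lemma geometric_failures : geometric_rv P p (failures xi).
Proof.
split=> [|x]; first exact: measurable_failures.
pose v := true :: nseq x false.
have <- : bit_weight p v = p * (1 - p) ^+ x.
  by rewrite /bit_weight big_cons big_nseq iter_mulr_1.
rewrite -(prob_past_bits hxi).
set A := _ @^-1` _; set A' := [set w | past (bits xi w) (size v) = v].
have mA : measurable A.
  by rewrite -[A]setTI; exact: measurable_failures.
have mA' : measurable A' by exact: measurable_past_bits.
rewrite -[A]setIT -[A']setIT -!integral_indic //.
apply: ge0_ae_eq_integral => //; try exact/measurable_EFinP/measurable_indic.
apply: filterS ae_failures => w [k [_ b0 b1 _ fk]] _; rewrite !indicE.
congr (_%:R%:E); congr nat_of_bool; apply/idP/idP; rewrite !inE /A /A' /= fk.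
  move=> /eqP; rewrite eqr_nat => /eqP kx; rewrite kx in b0 b1.
  rewrite size_nseq b1 /v; congr (_ :: _).
  by rewrite -past_const; apply/past_eqP.
rewrite size_nseq /v => -[b1' ]; rewrite -past_const => /past_eqP b0'.
congr (_%:R); apply/eqP; rewrite eqn_leq; apply/andP; split.
  rewrite leqNgt; apply/negP => xk.
  by move: b1'; rewrite b0 ?ltnS.
rewrite leqNgt; apply/negP => kx.
by move: b1; rewrite b0' ?ltnS.
Qed.

End failures.

(** The exponent has to be an integer: it is [-1] when [k = r], the case of the indices
    [1, ..., r.+1]. *)
Lemma sign_exprz (R : realType) (q : R) (r k : nat) : q != 0 ->
  (- 1) ^+ r * q ^ ((k.+1)%:Z - (r.+1)%:Z - 1) = (- q^-1) ^+ r * (q^-1 * q ^+ k).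
Proof.
move=> q0.
have -> : (k.+1)%:Z - (r.+1)%:Z - 1 = k%:Z + (- r%:Z) + (- 1%:Z) by lia.
rewrite !expfzDr // -!invr_expz -!exprnP expr1 [in RHS]exprNn exprVn.
by ring.
Qed.

(** * The terms of the expansion as random variables *)

Section expansion.
Context {d : measure_display} {T : measurableType d} {R : realType}.
Variables (P : probability T R) (p : R) (xi : nat -> {RV P >-> R}).
Variables (g : nat -> R) (s C : R).
Hypotheses (hp0 : 0 < p) (hp1 : p < 1) (hxi : bernoulli_trials p xi).
Hypotheses (s0 : 0 < s) (s1 : s < 1) (qs : 1 - p < s ^+ 3) (C0 : 0 <= C).
Hypothesis gle : forall j, `|g j| <= C * s ^- j.

Let q0 : 0 < 1 - p. Proof. by rewrite subr_gt0. Qed.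
(* One factor [s ^- 1] of the rate comes from the weighted Cauchy-Schwarz
   inequality, the other two from [g j ^+ 2]. *)
Let th := (1 - p) / s ^+ 3.
Let th0 : 0 <= th. Proof. by rewrite divr_ge0 ?exprn_ge0 ?ltW. Qed.
Let th1 : th < 1. Proof. by rewrite ltr_pdivrMr ?exprn_gt0 // mul1r. Qed.

Lemma measurable_chaos_sum (r : nat) :
  measurable_fun setT (fun w => chaos_sum p g (bits xi w) r).
Proof.
apply: (measurable_fun_limn (h := fun N w => series (chaos_term p g (bits xi w) r) N)).
move=> N; apply: measurable_sum => j; apply: measurable_funM.
  apply: measurable_funM => //.
  (* The head of the past of length [j.+1] is the bit of trial [j.+1]. *)
  exact: (measurable_past_bits_fun xi (fun v => (head false v)%:R - p) j.+1).
exact: (measurable_past_bits_fun xi (fun v => elem_sym (map (bit_ratio p) v) r) j).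
Qed.

(** The order [r] counts all indices of a tuple, the argument of [chaos_sum] only those below the
    largest. *)
Definition chaos_rv (r : nat) : {RV P >-> R} :=
  mfun_Sub (mem_set (measurable_chaos_sum r.-1)).

(** The second moment bound [(1 - p) ^- j] turns [k j] into [D * th ^+ j], and the tail vanishes for
    [j < m], so a geometric series starting at [m] remains. *)
Lemma integral_chaos_bound (D : R) (m : nat) : 0 <= D ->
  (\int[P]_w (\sum_(j <oo) (chaos_bound p (bits xi w) s D m j)%:E) <=
   (D / (1 - th) * th ^+ m)%:E)%E.
Proof.
move=> D0.
pose k j := D * ((1 - p) ^+ 2 / s ^+ 3) ^+ j.
have k0 j : 0 <= k j.
  by rewrite mulr_ge0 // exprn_ge0 // divr_ge0 ?exprn_ge0 ?(ltW q0) ?(ltW s0).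
pose F j v := k j * elem_sym_tail m (map (bit_ratio p) v) ^+ 2.
have F0 j v : 0 <= F j v by rewrite mulr_ge0 ?sqr_ge0.
have mF j : measurable_fun setT (fun w => (F j (past (bits xi w) j))%:E).
  by apply/measurable_EFinP; exact: measurable_past_bits_fun.
rewrite (integral_nneseries P measurableT
  (f := fun j w => (F j (past (bits xi w) j))%:E)) //; last first.
  by move=> j w _; rewrite lee_fin.
have intF j : (\int[P]_w (F j (past (bits xi w) j))%:E <=
    ((if (m <= j)%N then 1 else 0) * (D * th ^+ j))%:E)%E.
  rewrite (integral_past_bits hxi) // lee_fin /F.
  under eq_bigr do rewrite mulrCA.
  rewrite -mulr_sumr; case: leqP => [mj|jm]; last first.
    rewrite mul0r big1_seq ?mulr0 // => v /andP[_ /size_bitseqs vj].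
    by rewrite elem_sym_tail_oversize ?size_map ?vj // expr0n mulr0.
  rewrite mul1r.
  apply: (@le_trans _ _ (k j * (1 - p) ^- j)).
    by rewrite ler_wpM2l //; exact: elem_sym_tail_second_moment.
  rewrite /k -mulrA ler_wpM2l // -[(1 - p) ^- j]exprVn -exprMn le_eqVlt; apply/orP; left.
  by apply/eqP; congr (_ ^+ _); rewrite /th; field; rewrite ?expf_neq0 ?lt0r_neq0.
apply: (@le_trans _ _ (\sum_(j <oo) ((if (m <= j)%N then 1 else 0) * (D * th ^+ j))%:E)%E).
  apply: lee_nneseries => [j _ _|j _] //.
  by apply: integral_ge0 => w _; rewrite lee_fin.
apply: lime_le.
  apply: is_cvg_nneseries => j _ _; rewrite lee_fin.
  by case: ifP; rewrite ?mul0r ?mul1r // mulr_ge0 ?exprn_ge0.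
apply: nearW => N; rewrite sumEFin lee_fin.
have -> : \sum_(0 <= j < N) (if (m <= j)%N then 1 else 0) * (D * th ^+ j) =
    D * \sum_(m <= j < N) th ^+ j.
  rewrite mulr_sumr [RHS](big_nat_widenl _ 0) // [RHS]big_mkcondr /=.
  by apply: eq_bigr => j _; case: ifP; rewrite ?mul1r ?mul0r.
rewrite -mulrA ler_wpM2l // mulrC; exact: sum_geometric_le.
Qed.

Lemma cvg_chaos_rv (K : nat -> nat -> {poly R}) : krawtchouk_family p K ->
  {ae P, forall w, forall r, (0 < r)%N ->
    \sum_(r <= l < m)
      ((r - 1)`!%:R^-1
      * (K (r - 1)%N (l - 1)%N).[successes xi (l - 1)%N w]
      * (xi l w - p) * (-1) ^+ (r - 1)
      * (1 - p) ^ (l%:Z - r%:Z - 1)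
      * g (l - 1)%N) @[m --> \oo] --> chaos_rv r w}.
Proof.
move=> hK; apply: filterS (ae_bits hxi) => w xb [//|r] _.
rewrite subn1 /=.
have cS : series (chaos_term p g (bits xi w) r) @ \oo --> chaos_rv r.+1 w.
  exact: (cvg_chaos_term hp0 hp1 s0 s1 qs C0 gle).
rewrite -cvg_shiftS; apply: cvg_trans cS; apply: near_eq_cvg; near=> m.
have rm : (r <= m)%N by near: m; exact: nbhs_infty_ge.
(* After the shift the sum starts at [j = r], the series at [j = 0]; the terms in between vanish,
   having degree [r] in fewer than [r] variables. *)
rewrite /= big_add1 /= /series /= (big_cat_nat (n := r)) //= big1_seq ?add0r.
  apply: eq_big_nat => j /andP[rj jm].
  rewrite chaos_termE // subn1 /=.
  have -> : successes xi j w = (count id (past (bits xi w) j))%:R.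
    rewrite /successes count_past natr_sum.
    by rewrite !big_nat; apply: eq_bigr => i /andP[i0 _]; rewrite xb.
  rewrite -[in K r j](size_past (bits xi w) j) (krawtchouk_elem_sym hK) ?size_past //.
  rewrite map_past xb // [X in _ * X * _]mulrA -sign_exprz ?lt0r_neq0 //.
  by move: ((1 - p) ^ _) ((- 1) ^+ r) => z u; ring.
move=> j /andP[_]; rewrite mem_index_iota => /andP[_ jr].
by rewrite /chaos_term elem_sym_oversize ?mulr0 // size_map size_past.
Unshelve. all: by end_near.
Qed.

Lemma has_sum_chaos_rv :
  {ae P, forall w, forall r, (0 < r)%N ->
    has_sum (fun t : incr_tuple r =>
      (\prod_(i <- val t) (xi i w - p)) * (-1) ^+ (r - 1)
      * (1 - p) ^ ((max_index t)%:Z - r%:Z - 1)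
      * g (max_index t - 1)%N) (chaos_rv r w)}.
Proof.
apply: filterS (ae_bits hxi) => w xb [//|r] _.
have H : has_sum _ (chaos_rv r.+1 w) :=
  @has_sum_chaos R p g (bits xi w) hp0 hp1 s C s0 s1 qs C0 gle r.
move: H; congr (has_sum _ _); apply/funext => t.
have tpath : path ltn 0%N (val t) := valP t.
(* Positivity matters twice: [bits] represents [xi] at positive indices, and [max_index t] must be a
   successor. *)
have tpos i : i \in val (val t) -> (0 < i)%N.
  by move: tpath; rewrite (path_sortedE ltn_trans) => /andP[/allP + _]; exact.
have mpos : (0 < max_index t)%N.
  apply: tpos; rewrite /max_index; case: (val t) => -[//|a u] /= _.
  exact: mem_last.
rewrite !subn1 /= -[in (max_index t)%:Z](prednK mpos).
rewrite -!mulrA; congr (_ * _).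
  by apply: eq_big_seq => i /tpos i0; rewrite xb.
by rewrite !mulrA sign_exprz ?lt0r_neq0 // !mulrA.
Qed.

Lemma rv_series_chaos (Y : T -> R) : measurable_fun setT Y ->
  {ae P, forall w, series (chaos_rest p g (bits xi w) 0) @ \oo --> Y w} ->
  rv_series chaos_rv Y.
Proof.
move=> mY aeY.
pose D := (1 - s)^-1 * (1 - p) ^- 2 * C ^+ 2.
have D0 : 0 <= D.
  by rewrite !mulr_ge0 ?invr_ge0 ?exprn_ge0 ?subr_ge0 ?(ltW hp1) ?(ltW s1).
have B0 w m j : 0 <= chaos_bound p (bits xi w) s D m j.
  rewrite /chaos_bound mulr_ge0 ?sqr_ge0 // mulr_ge0 // exprn_ge0 //.
  by rewrite divr_ge0 ?exprn_ge0 ?(ltW q0) ?(ltW s0).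
apply: (@rv_series_of_summable_bound _ _ _ _ _ _
  (fun m w => \sum_(j <oo) (chaos_bound p (bits xi w) s D m j)%:E)%E
  (fun m => D / (1 - th) * th ^+ m)) => //.
- move=> m; apply: ge0_emeasurable_sum => [j w _ _|j _]; first by rewrite lee_fin.
  apply/measurable_EFinP.
  exact: (measurable_past_bits_fun xi (fun v => D * ((1 - p) ^+ 2 / s ^+ 3) ^+ j *
    elem_sym_tail m (map (bit_ratio p) v) ^+ 2)).
- by move=> m w; apply: nneseries_ge0 => j _ _; rewrite lee_fin.
- apply: filterS aeY => w cY m; rewrite big_add1 /=.
  exact: chaos_residual_le.
- by move=> m; exact: integral_chaos_bound.
- by apply: is_cvg_geometric_series; rewrite ger0_norm.
Qed.

End expansion.

Theorem theorem2 (d : measure_display) (T : measurableType d) (R : realType)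
    (P : probability T R) (p q : R) (xi : nat -> {RV P >-> R})
    (M : nat -> {poly R}) (K : nat -> nat -> {poly R})
    (hp0 : 0 < p) (hp1 : p < 1) (hq : q = 1 - p)
    (hxi : bernoulli_trials p xi)
    (hM : meixner_family q M) (hK : krawtchouk_family p K) :
  [/\ {ae P, forall w, exists k : nat,
        [/\ failures_partial xi m w @[m --> \oo] --> (k%:R : R),
            xi k.+1 w = 1 &
            forall i : nat, (0 < i)%N -> (i <= k)%N -> xi i w = 0]},
      geometric_rv P p (failures xi) &
      forall n : nat, (0 < n)%N ->
        (exists S : nat -> {RV P >-> R},
           {ae P, forall w, forall r : nat, (0 < r)%N ->
              has_sum (fun t : incr_tuple r =>
                (\prod_(i <- val t) (xi i w - p)) * (-1) ^+ (r - 1)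
                * q ^ ((max_index t)%:Z - r%:Z - 1)
                * (M (n - 1)%N).[(max_index t - 1)%:R]) (S r w)} /\
           rv_series S (fun w => (M n).[failures xi w])) /\
        (exists S : nat -> {RV P >-> R},
           {ae P, forall w, forall r : nat, (0 < r)%N ->
              \sum_(r <= l < m)
                ((r - 1)`!%:R^-1
                * (K (r - 1)%N (l - 1)%N).[successes xi (l - 1)%N w]
                * (xi l w - p) * (-1) ^+ (r - 1)
                * q ^ (l%:Z - r%:Z - 1)
                * (M (n - 1)%N).[(l - 1)%:R]) @[m --> \oo] --> S r w} /\
           rv_series S (fun w => (M n).[failures xi w]))].
Proof.
have aeX := ae_failures hp0 hp1 hxi.
split; last 2 first.
- exact: geometric_failures.
- move=> [//|n] _; rewrite subn1 /=; subst q.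
  (* The mean of [1], [1] and [1 - p]: by the inequality of arithmetic and geometric means its cube
     exceeds [1 - p], with the explicit gap below. *)
  pose s : R := (2 + (1 - p)) / 3.
  have s0 : 0 < s by rewrite /s; lra.
  have s1 : s < 1 by rewrite /s; lra.
  have qs : 1 - p < s ^+ 3.
    rewrite -subr_gt0.
    have -> : s ^+ 3 - (1 - p) = p ^+ 2 * (9 - p) / 27 by rewrite /s; field.
    by rewrite divr_gt0 // mulr_gt0 ?exprn_gt0 //; lra.
  have sV : 1 < s^-1 by rewrite invf_gt1.
  have [C C0 HC] := poly_nat_le_expr (M n) sV.
  pose g (j : nat) := (M n).[j%:R].
  have gle j : `|g j| <= C * s ^- j by rewrite -exprVn HC.
  have rs : rv_series (chaos_rv p xi g) (fun w => (M n.+1).[failures xi w]).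
    apply: (rv_series_chaos hp0 hp1 hxi s0 s1 qs C0 gle).
      have -> : (fun w => (M n.+1).[failures xi w]) =
          (fun w => \sum_(i < size (M n.+1)) (M n.+1)`_i * failures xi w ^+ i).
        by apply/funext => w; rewrite horner_coef.
      apply: measurable_sum => i; apply: measurable_funM => //.
      by apply: measurable_funX; exact: measurable_failures.
    (* When the first success is trial [k.+1], the partial sums with more than [k] terms are
       constant, with the value given by [meixner_sum]. *)
    apply: filterS aeX => w [k [_ b0 b1 _ ->]].
    rewrite (meixner_sum n k _ hM) ?lt_eqF //.
    apply: cvg_near_cst; near=> N; apply: (sum_chaos_rest0 g hp1 b0 b1).
    by near: N; exact: nbhs_infty_gt.
  (* The same random variables serve both representations. *)
  split; exists (chaos_rv p xi g); split => //.
    exact: (has_sum_chaos_rv hp0 hp1 hxi s0 s1 qs C0 gle).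
  exact: (cvg_chaos_rv hp0 hp1 hxi s0 s1 qs C0 gle hK).
apply: filterS aeX => w [k [xb b0 b1 fk _]]; exists k; split => //.
  by rewrite xb // b1.
by move=> i i0 ik; rewrite xb // b0 ?i0.
Unshelve. all: by end_near.
Qed.
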